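(* Let $E$ be a fixed recursive specification and consider closed process expressions of $\mathrm{TCP}^{\bullet}$ with the structural operational semantics described in the context. Rooted divergence-preserving branching bisimilarity $\simeq^{\Delta}_{rb}$ is a congruence for the operators of $\mathrm{TCP}^{\bullet}$: for all closed process expressions $P,Q,P_1,P_2,Q_1,Q_2$, every action $a\in\mathcal{A}_\tau$ and every set of channels $\mathcal{C}'$, if $P\simeq^{\Delta}_{rb}Q$ then $a.P\simeq^{\Delta}_{rb}a.Q$, and if $P_1\simeq^{\Delta}_{rb}Q_1$ and $P_2\simeq^{\Delta}_{rb}Q_2$ then $P_1+P_2\simeq^{\Delta}_{rb}Q_1+Q_2$, $P_1\bullet P_2\simeq^{\Delta}_{rb}Q_1\bullet Q_2$ and $[P_1\parallel P_2]_{\mathcal{C}'}\simeq^{\Delta}_{rb}[Q_1\parallel Q_2]_{\mathcal{C}'}$.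
   Context: $\mathcal{A}$ is a set of actions, $\tau\notin\mathcal{A}$ is the internal action, $\mathcal{A}_\tau=\mathcal{A}\cup\{\tau\}$. There is a set $\mathcal{C}$ of channels and a set $\mathcal{D}$ of data; for $\mathcal{C}'\subseteq\mathcal{C}$, $\mathcal{I}_{\mathcal{C}'}=\{c?d,\,c!d\mid c\in\mathcal{C}',d\in\mathcal{D}\}\subseteq\mathcal{A}$. Process expressions of $\mathrm{TCP}^{\bullet}$ are generated by $P::=\mathbf{0}\mid\mathbf{1}\mid a.P\mid P\bullet P\mid P+P\mid N\mid[P\parallel P]_{\mathcal{C}'}$ with $a\in\mathcal{A}_\tau$, $N$ a name from a countable set of names, $\mathcal{C}'\subseteq\mathcal{C}$. A recursive specification $E$ is a set of equations $N\overset{def}{=}P$ with at most one equation per name and a defining equation for every name occurring in a right-hand side. The transition relation $P\xrightarrow{a}P'$ and termination predicate $P\downarrow$ are the least ones (in the sense of well-supported proofs, since there is a negative premise) satisfying: $\mathbf{1}\downarrow$; $a.P\xrightarrow{a}P$; if $P_1\xrightarrow{a}P_1'$ then $P_1+P_2\xrightarrow{a}P_1'$ and $P_2+P_1\xrightarrow{a}P_1'$; if $P_1\downarrow$ then $P_1+P_2\downarrow$ and $P_2+P_1\downarrow$; if $P_1\downarrow$ and $P_2\downarrow$ then $P_1\bullet P_2\downarrow$; if $P_1\xrightarrow{a}P_1'$ then $P_1\bullet P_2\xrightarrow{a}P_1'\bullet P_2$; if $P_1\downarrow$, $P_2\xrightarrow{a}P_2'$ and $P_1$ has no outgoing transition at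 all, then $P_1\bullet P_2\xrightarrow{a}P_2'$; if $(N\overset{def}{=}P)\in E$ and $P\xrightarrow{a}P'$ then $N\xrightarrow{a}P'$, and if $P\downarrow$ then $N\downarrow$; if $P_1\xrightarrow{a}P_1'$ with $a\notin\mathcal{I}_{\mathcal{C}'}$ then $[P_1\parallel P_2]_{\mathcal{C}'}\xrightarrow{a}[P_1'\parallel P_2]_{\mathcal{C}'}$ (and symmetrically for $P_2$); if $P_1\downarrow$ and $P_2\downarrow$ then $[P_1\parallel P_2]_{\mathcal{C}'}\downarrow$; if $P_1\xrightarrow{c?d}P_1'$, $P_2\xrightarrow{c!d}P_2'$ and $c\in\mathcal{C}'$ then $[P_1\parallel P_2]_{\mathcal{C}'}\xrightarrow{\tau}[P_1'\parallel P_2']_{\mathcal{C}'}$ (and symmetrically). On this transition system (states: process expressions), write $s\xrightarrow{(a)}t$ for ''$s\xrightarrow{a}t$ or ($a=\tau$ and $s=t$)'', $\to^*$ for the reflexive-transitive closure and $\to^+$ for the transitive closure of $\xrightarrow{\tau}$. A branching bisimulation is a symmetric relation $R$ such that $sRt$ implies: (1) if $s\xrightarrow{a}s'$ then there are $t'',t'$ with $t\to^*t''\xrightarrow{(a)}t'$, $sRt''$ and $s'Rt'$; (2) if $s\downarrow$ then there is $t'$ with $t\to^*t'$, $t'\downarrow$ and $sRt'$. It is divergence-preserving if moreover $sRt$ implies: (3) if there is an infinite sequence $s=s_0\xrightarrow{\tau}s_1\xrightarrow{\tau}\cdots$ with $s_iRt$ for all $i$, then there is $t'$ with $t\to^+t'$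 and $s_iRt'$ for some $i$. $s_1\simeq^{\Delta}_{rb}s_2$ (rooted divergence-preserving branching bisimilar) if there is a divergence-preserving branching bisimulation $R$ with $s_1Rs_2$ such that: if $s_1\xrightarrow{a}s_1'$ then $s_2\xrightarrow{a}s_2'$ for some $s_2'$ with $s_1'Rs_2'$, and if $s_1\downarrow$ then $s_2\downarrow$.
   Formalization: The root condition is required in both directions (one-sided, the claim fails for + with a.0 and a.0+τ.a.0); the clause for P1•P2 assumes that the rules with E are complete, i.e. well-supported proofs decide every absence of transitions (it fails for N = N•a.0+1). *)

(* Defs.v *)
From Stdlib Require Import Relations.
From mathcomp Require Import all_boot classical_sets.

Set Implicit Arguments.
Unset Strict Implicit.
Unset Printing Implicit Defensive.

Local Open Scope classical_set_scope.

(* Every set of actions containing all c?d and c!d has this shape, with [B]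
   the type of the remaining actions. *)
Inductive action (B C D : Type) : Type :=
| recv of C & D
| send of C & D
| other of B.
Arguments recv {B C D}.
Arguments send {B C D}.
Arguments other {B C D}.

Definition action_tau (B C D : Type) : Type := option (action B C D).

Definition tau {B C D : Type} : action_tau B C D := None.

Definition comm (B C D : Type) (C' : set C) : set (action_tau B C D) :=
  [set a | exists c d, C' c /\ (a = Some (recv c d) \/ a = Some (send c d))].

Inductive proc (B C D : Type) (Name : countType) : Type :=
| pzero
| pone
| pprefix of action_tau B C D & proc B C D Name
| pseq of proc B C D Name & proc B C D Name
| pplus of proc B C D Name & proc B C D Name
| pname of Name
| ppar of set C & proc B C D Name & proc B C D Name.
Arguments pzero {B C D Name}.
Arguments pone {B C D Name}.
Arguments pname {B C D Name}.

Fixpoint occurs (B C D : Type) (Name : countType) (M : Name)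
    (P : proc B C D Name) : Prop :=
  match P with
  | pzero | pone => False
  | pprefix _ P1 => occurs M P1
  | pseq P1 P2 | pplus P1 P2 | ppar _ P1 P2 => occurs M P1 \/ occurs M P2
  | pname N => N = M
  end.

Record rec_spec (B C D : Type) (Name : countType) : Type := RecSpec {
  equation :> Name -> proc B C D Name -> Prop;
  equation_unique : forall N P Q, equation N P -> equation N Q -> P = Q;
  equation_closed : forall N P M,
    equation N P -> occurs M P -> exists Q, equation M Q
}.

(* [lneg P a] is the negative literal "P has no outgoing a-transition". *)
Inductive literal (B C D : Type) (Name : countType) : Type :=
| ltrans of proc B C D Name & action_tau B C D & proc B C D Name
| lterm of proc B C D Name
| lneg of proc B C D Name & action_tau B C D.

Definition negative (B C D : Type) (Name : countType)
    (l : literal B C D Name) : Prop :=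
  if l is lneg _ _ then True else False.

Definition denies (B C D : Type) (Name : countType)
    (l m : literal B C D Name) : Prop :=
  match l, m with
  | ltrans P a _, lneg Q b | lneg P a, ltrans Q b _ => P = Q /\ a = b
  | _, _ => False
  end.

(* [sos_rule E H l]: H / l is a closed instance of an operational rule. *)
Inductive sos_rule (B C D : Type) (Name : countType)
    (E : rec_spec B C D Name) :
    set (literal B C D Name) -> literal B C D Name -> Prop :=
| sos_one : sos_rule E set0 (lterm pone)
| sos_prefix a P : sos_rule E set0 (ltrans (pprefix a P) a P)
| sos_plusl a P1 P1' P2 :
    sos_rule E [set ltrans P1 a P1'] (ltrans (pplus P1 P2) a P1')
| sos_plusr a P1 P1' P2 :
    sos_rule E [set ltrans P1 a P1'] (ltrans (pplus P2 P1) a P1')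
| sos_plusl_term P1 P2 : sos_rule E [set lterm P1] (lterm (pplus P1 P2))
| sos_plusr_term P1 P2 : sos_rule E [set lterm P1] (lterm (pplus P2 P1))
| sos_seq_term P1 P2 :
    sos_rule E [set lterm P1; lterm P2] (lterm (pseq P1 P2))
| sos_seql a P1 P1' P2 :
    sos_rule E [set ltrans P1 a P1'] (ltrans (pseq P1 P2) a (pseq P1' P2))
| sos_seqr a P1 P2 P2' :
    sos_rule E ([set lterm P1; ltrans P2 a P2'] `|` range (lneg P1))
      (ltrans (pseq P1 P2) a P2')
| sos_name a N P P' :
    E N P -> sos_rule E [set ltrans P a P'] (ltrans (pname N) a P')
| sos_name_term N P : E N P -> sos_rule E [set lterm P] (lterm (pname N))
| sos_parl C' a P1 P1' P2 :
    ~ comm C' a ->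
    sos_rule E [set ltrans P1 a P1'] (ltrans (ppar C' P1 P2) a (ppar C' P1' P2))
| sos_parr C' a P1 P2 P2' :
    ~ comm C' a ->
    sos_rule E [set ltrans P2 a P2'] (ltrans (ppar C' P1 P2) a (ppar C' P1 P2'))
| sos_par_term C' P1 P2 :
    sos_rule E [set lterm P1; lterm P2] (lterm (ppar C' P1 P2))
| sos_comml (C' : set C) c d P1 P1' P2 P2' :
    C' c ->
    sos_rule E [set ltrans P1 (Some (recv c d)) P1';
                    ltrans P2 (Some (send c d)) P2']
      (ltrans (ppar C' P1 P2) tau (ppar C' P1' P2'))
| sos_commr (C' : set C) c d P1 P1' P2 P2' :
    C' c ->
    sos_rule E [set ltrans P1 (Some (send c d)) P1';
                    ltrans P2 (Some (recv c d)) P2']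
      (ltrans (ppar C' P1 P2) tau (ppar C' P1' P2')).

(* Provability of the rule H / l from the operational rules. *)
Inductive provable (B C D : Type) (Name : countType)
    (E : rec_spec B C D Name) (H : set (literal B C D Name)) :
    literal B C D Name -> Prop :=
| provable_hyp l : H l -> provable E H l
| provable_rule K l :
    sos_rule E K l -> (forall k, K k -> provable E H k) -> provable E H l.

(* Well-supported provability of a literal (R.J. van Glabbeek, The meaning of
   negative premises in transition system specifications II). *)
Inductive ws_provable (B C D : Type) (Name : countType)
    (E : rec_spec B C D Name) : literal B C D Name -> Prop :=
| ws_rule K l :
    sos_rule E K l -> (forall k, K k -> ws_provable E k) -> ws_provable E l
| ws_negative K l :
    negative l ->
    (forall (H : set (literal B C D Name)) m,
        (forall h, H h -> negative h) -> denies m l -> provable E H m ->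
        exists k h, [/\ K k, H h & denies k h]) ->
    (forall k, K k -> ws_provable E k) ->
    ws_provable E l.

(* The operational rules with E are complete: each negative literal is settled
   by a well-supported proof.  This is van Glabbeek's criterion for rules with
   negative premises to define a transition relation.  It can fail for
   unguarded recursion, e.g. for N = (N seq a.0) + 1: then N terminates and no
   transition of N is provable, but neither is the absence of a-transitions;
   so N is bisimilar to 1, whereas N seq a.0, unlike 1 seq a.0, has no
   provable transition. *)
Definition complete (B C D : Type) (Name : countType)
    (E : rec_spec B C D Name) : Prop :=
  forall P a,
    ws_provable E (lneg P a) \/ exists P', ws_provable E (ltrans P a P').

Definition trans (B C D : Type) (Name : countType) (E : rec_spec B C D Name)
    (P : proc B C D Name) (a : action_tau B C D) (P' : proc B C D Name) : Prop :=
  ws_provable E (ltrans P a P').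

Definition term (B C D : Type) (Name : countType) (E : rec_spec B C D Name)
    (P : proc B C D Name) : Prop :=
  ws_provable E (lterm P).

Definition tau_step (B C D : Type) (Name : countType)
    (E : rec_spec B C D Name) : relation (proc B C D Name) :=
  fun s t => trans E s tau t.

Definition opt_trans (B C D : Type) (Name : countType)
    (E : rec_spec B C D Name) (s : proc B C D Name) (a : action_tau B C D)
    (t : proc B C D Name) : Prop :=
  trans E s a t \/ (a = tau /\ s = t).

Definition branching_bisimulation (B C D : Type) (Name : countType)
    (E : rec_spec B C D Name) (R : relation (proc B C D Name)) : Prop :=
  [/\ forall s t, R s t -> R t s,
      forall s t a s', R s t -> trans E s a s' ->
        exists t'' t', [/\ clos_refl_trans _ (tau_step E) t t'',
                           opt_trans E t'' a t', R s t'' & R s' t']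
    & forall s t, R s t -> term E s ->
        exists t', [/\ clos_refl_trans _ (tau_step E) t t',
                       term E t' & R s t']].

Definition divergence_preserving (B C D : Type) (Name : countType)
    (E : rec_spec B C D Name) (R : relation (proc B C D Name)) : Prop :=
  forall s t (f : nat -> proc B C D Name),
    R s t -> f 0 = s -> (forall i, tau_step E (f i) (f i.+1)) ->
    (forall i, R (f i) t) ->
    exists t' i, clos_trans _ (tau_step E) t t' /\ R (f i) t'.

Definition root_condition (B C D : Type) (Name : countType)
    (E : rec_spec B C D Name) (R : relation (proc B C D Name))
    (s1 s2 : proc B C D Name) : Prop :=
  (forall a s1', trans E s1 a s1' ->
     exists s2', trans E s2 a s2' /\ R s1' s2') /\
  (term E s1 -> term E s2).

(* The root condition is imposed in both directions: imposed only from s1 to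
   s2 it would not define a symmetric relation. *)
Definition rooted_dp_branching_bisimilar (B C D : Type) (Name : countType)
    (E : rec_spec B C D Name) (s1 s2 : proc B C D Name) : Prop :=
  exists R : relation (proc B C D Name),
    [/\ branching_bisimulation E R, divergence_preserving E R, R s1 s2,
        root_condition E R s1 s2 & root_condition E R s2 s1].

(* Main.v *)
Require Import Defs.
From Stdlib Require Import Relations Wellfounded.
From mathcomp Require Import all_boot boolp classical_sets.

Set Implicit Arguments.
Unset Strict Implicit.
Unset Printing Implicit Defensive.

Local Open Scope classical_set_scope.

(** Divergence preservation of a branching bisimulation [R] is equivalent to a
    well-foundedness property: if [s R t], there is no infinite tau-path from
    [s] all of whose states are unrelated to every proper tau-descendant of [t].
    In this form it is stable under unions and can be proved by well-founded
    induction for the relations obtained by closing under an operator: a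
    tau-step of a compound process either is a tau-step of a component or is
    answered by a proper tau-step.

    For sequential composition, let [X] be terminated and without transitions
    and let [X R Y].  Every transition of [Y] is then a tau-step to a state that
    is again related to [X], and [Y] does not diverge, so [Y] silently reaches a
    terminated state without transitions, from which the second component can
    start.  Well-supported provability is consistent, so for a complete
    specification the negative premises of this rule express exactly the absence
    of transitions. *)

(** * Infinite descending paths, accessibility and closures of relations *)

Lemma not_Acc_path (T : Type) (R : relation T) (x : T) : ~ Acc R x ->
  exists2 f : nat -> T, f 0 = x & forall i, R (f i.+1) (f i).
Proof.
move=> nx.
(* On the subtype of inaccessible points predecessors always exist, so a choice function can be
   iterated. *)
have next (y : {y : T | ~ Acc R y}) : exists z : {z : T | ~ Acc R z},
    R (sval z) (sval y).
  case: y => y ny; apply: contrapT => nex; apply: (ny); constructor=> z zy.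
  by apply: contrapT => nz; apply: nex; exists (exist _ z nz).
have [f fP] := choice next.
by exists (fun i => sval (iter i f (exist _ x nx))) => [|i] /=; last exact: fP.
Qed.

Lemma Acc_no_path (T : Type) (R : relation T) (x : T) : Acc R x ->
  forall f : nat -> T, f 0 = x -> ~ (forall i, R (f i.+1) (f i)).
Proof.
elim=> {}x _ IH f f0 fR.
by apply: (IH (f 1) _ (fun i => f i.+1)) => //; rewrite -f0.
Qed.

Section Closures.
Variables (T U : Type) (R : relation T) (S : relation U).

Lemma clos_rt_eq_or_t x y : clos_refl_trans _ R x y ->
  x = y \/ clos_trans _ R x y.
Proof.
elim=> {x y} [x y xy|x|x y z _ [->|xy] _ [<-|yz]]; try by [left|right].
- by right; constructor.
- by right; apply: t_trans xy yz.
Qed.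

Variable F : T -> U.
Hypothesis FP : forall x y, R x y -> S (F x) (F y).

Lemma clos_rt_map x y : clos_refl_trans _ R x y ->
  clos_refl_trans _ S (F x) (F y).
Proof.
by elim=> {x y} [x y /FP|x|x y z _ xy _ yz]; [apply: rt_step|apply: rt_refl|apply: rt_trans xy yz].
Qed.

Lemma clos_t_map x y : clos_trans _ R x y -> clos_trans _ S (F x) (F y).
Proof.
by elim=> {x y} [x y /FP|x y z _ xy _ yz]; [apply: t_step|apply: t_trans xy yz].
Qed.

End Closures.

Section Congruence.
Variables (B C D : Type) (Name : countType) (E : rec_spec B C D Name).

Local Notation process := (proc B C D Name).
Local Notation tau_star := (clos_refl_trans process (tau_step E)).
Local Notation tau_plus := (clos_trans process (tau_step E)).
Local Notation tr := (trans E).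
Local Notation ter := (term E).

Implicit Types (P Q X Y s t : process) (R : relation process).

(** * Well-supported provability *)

(** Cutting a well-supported proof at its negative literals leaves an ordinary proof from them. *)
Lemma provable_ws_negatives l : ws_provable E l ->
  provable E [set h | negative h /\ ws_provable E h] l.
Proof.
elim=> {l} [K l rl _ IH|K l nl hl hK _]; first exact: provable_rule rl IH.
by apply: provable_hyp; split=> //; apply: ws_negative nl hl hK.
Qed.

(** No operational rule concludes a negative literal, so the proof must end with [ws_negative]. *)
Lemma ws_lneg_support P a : ws_provable E (lneg P a) ->
  exists2 K : set (literal B C D Name), forall k, K k -> ws_provable E k &
    forall (H : set (literal B C D Name)) m,
      (forall h, H h -> negative h) -> denies m (lneg P a) -> provable E H m ->
      exists k h, [/\ K k, H h & denies k h].
Proof.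
move=> w; inversion w as [K l rl hK|K l nl hl hK]; first by inversion rl.
by exists K.
Qed.

(* The literals of this set are denied by no well-supported literal; generating
   proofs from them only is what makes the induction for consistency work. *)
Lemma provable_undenied l : ws_provable E l ->
  provable E [set h | negative h /\
                      forall m, ws_provable E m -> ~ denies m h] l.
Proof.
elim=> {l} [K l rl _ IH|K l nl hl hK IH]; first exact: provable_rule rl IH.
apply: provable_hyp; split=> // m wm dm.
have [k [h [Kk [nh wh] dkh]]] :=
  hl _ m (fun h => @proj1 _ _) dm (provable_ws_negatives wm).
(* The literal [h] is well-supported too, so its support [K'] must deny one of the hypotheses from
   which [k] is provable by induction; but these are undenied. *)
case: h nh wh dkh => // P a _ /ws_lneg_support[K' wK' hK'] dk.
have [k' [h' [K'k' [_ nh'] dk']]] := hK' _ k (fun h => @proj1 _ _) dk (IH k Kk).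
exact: nh' (wK' _ K'k') dk'.
Qed.

(** Otherwise the support of the negative literal would deny an undenied hypothesis. *)
Lemma ws_consistent P a P' : ws_provable E (lneg P a) -> ~ tr P a P'.
Proof.
move=> /ws_lneg_support[K wK hK] w.
have [k [h [Kk [_ nh] dkh]]] :=
  hK _ (ltrans P a P') (fun h => @proj1 _ _) (conj erefl erefl) (provable_undenied w).
exact: nh (wK _ Kk) dkh.
Qed.

Definition deadlocked P := forall a P', ~ tr P a P'.

(** * Transitions of compound processes *)

(** A positive literal cannot come from [ws_negative], so one goal per applicable rule remains, with
    [hK] giving its premises. *)
Ltac invert w :=
  let K := fresh in let l := fresh in let r := fresh in let hK := fresh "hK" in
  inversion w as [K l r hK|K l n]; [inversion r|case: n]; subst.

Lemma trans_prefix a P : tr (pprefix a P) a P.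
Proof. by apply: ws_rule (sos_prefix E a P) _. Qed.

Lemma trans_prefixP a P b P' : tr (pprefix a P) b P' -> a = b /\ P = P'.
Proof. by move=> w; invert w. Qed.

Lemma term_prefix a P : ~ ter (pprefix a P).
Proof. by move=> w; invert w. Qed.

Lemma trans_plusl a P Q P' : tr P a P' -> tr (pplus P Q) a P'.
Proof. by move=> w; apply: ws_rule (sos_plusl E a P P' Q) _ => k ->. Qed.

Lemma trans_plusr a P Q P' : tr P a P' -> tr (pplus Q P) a P'.
Proof. by move=> w; apply: ws_rule (sos_plusr E a P P' Q) _ => k ->. Qed.

Lemma trans_plusP a P Q X : tr (pplus P Q) a X -> tr P a X \/ tr Q a X.
Proof. by move=> w; invert w; [left|right]; apply: hK. Qed.

Lemma term_plusl P Q : ter P -> ter (pplus P Q).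
Proof. by move=> w; apply: ws_rule (sos_plusl_term E P Q) _ => k ->. Qed.

Lemma term_plusr P Q : ter P -> ter (pplus Q P).
Proof. by move=> w; apply: ws_rule (sos_plusr_term E P Q) _ => k ->. Qed.

Lemma term_plusP P Q : ter (pplus P Q) -> ter P \/ ter Q.
Proof. by move=> w; invert w; [left|right]; apply: hK. Qed.

Lemma trans_seql a P Q P' : tr P a P' -> tr (pseq P Q) a (pseq P' Q).
Proof. by move=> w; apply: ws_rule (sos_seql E a P P' Q) _ => k ->. Qed.

(** Completeness turns the absence of transitions of [P] into well-supported proofs of all negative
    premises. *)
Lemma trans_seqr a P Q Q' : complete E -> ter P -> deadlocked P ->
  tr Q a Q' -> tr (pseq P Q) a Q'.
Proof.
move=> cE tP dP w; apply: ws_rule (sos_seqr E a P Q Q') _.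
move=> k [[->|->] //|[b _ <-]].
by have [//|[P' /dP]] := cE P b.
Qed.

(** Consistency turns the negative premises of the rule back into a genuine absence of
    transitions. *)
Lemma trans_seqP a P Q X : tr (pseq P Q) a X ->
  (exists2 P', X = pseq P' Q & tr P a P') \/ [/\ ter P, deadlocked P & tr Q a X].
Proof.
move=> w; invert w; [left|right].
  by exists P1' => //; apply: hK.
split; [by apply: hK; left; left| |by apply: hK; left; right].
by move=> b P'; apply: ws_consistent; apply: hK; right; exists b.
Qed.

Lemma term_seq P Q : ter P -> ter Q -> ter (pseq P Q).
Proof. by move=> *; apply: ws_rule (sos_seq_term E P Q) _ => k [] ->. Qed.

Lemma term_seqP P Q : ter (pseq P Q) -> ter P /\ ter Q.
Proof. by move=> w; invert w; split; apply: hK; [left|right]. Qed.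

Lemma trans_parl C' a P Q P' : ~ comm C' a -> tr P a P' ->
  tr (ppar C' P Q) a (ppar C' P' Q).
Proof. by move=> na w; apply: ws_rule (sos_parl E P P' Q na) _ => k ->. Qed.

Lemma trans_parr C' a P Q Q' : ~ comm C' a -> tr Q a Q' ->
  tr (ppar C' P Q) a (ppar C' P Q').
Proof. by move=> na w; apply: ws_rule (sos_parr E P Q Q' na) _ => k ->. Qed.

(** Merges the two communication rules, so that later arguments treat both orientations at once. *)
Definition handshake (C' : set C) (a b : action_tau B C D) : Prop :=
  exists c d, C' c /\
    (a = Some (recv c d) /\ b = Some (send c d) \/
     a = Some (send c d) /\ b = Some (recv c d)).

Lemma trans_comm C' a b P Q P' Q' : handshake C' a b -> tr P a P' -> tr Q b Q' ->
  tr (ppar C' P Q) tau (ppar C' P' Q').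
Proof.
move=> [c [d [cC' [[-> ->]|[-> ->]]]]] wP wQ.
- by apply: ws_rule (sos_comml E d P P' Q Q' cC') _ => k [] ->.
- by apply: ws_rule (sos_commr E d P P' Q Q' cC') _ => k [] ->.
Qed.

Lemma handshake_visible C' a b : handshake C' a b -> a <> tau /\ b <> tau.
Proof. by move=> [c [d [_ [[-> ->]|[-> ->]]]]]. Qed.

Lemma tau_not_comm (C' : set C) : ~ comm C' (@tau B C D).
Proof. by move=> [c [d [_ []]]]. Qed.

Lemma trans_parP C' a P Q X : tr (ppar C' P Q) a X ->
  [\/ ~ comm C' a /\ exists2 P', X = ppar C' P' Q & tr P a P',
      ~ comm C' a /\ exists2 Q', X = ppar C' P Q' & tr Q a Q'
    | a = tau /\ exists b b' P' Q',
        [/\ X = ppar C' P' Q', handshake C' b b', tr P b P' & tr Q b' Q']].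
Proof.
move=> w; invert w.
- by constructor 1; split=> //; exists P1' => //; apply: hK.
- by constructor 2; split=> //; exists P2' => //; apply: hK.
- constructor 3; split=> //.
  exists (Some (recv c d)), (Some (send c d)), P1', P2'; split=> //.
  + by exists c, d; split=> //; left.
  + by apply: hK; left.
  + by apply: hK; right.
- constructor 3; split=> //.
  exists (Some (send c d)), (Some (recv c d)), P1', P2'; split=> //.
  + by exists c, d; split=> //; right.
  + by apply: hK; left.
  + by apply: hK; right.
Qed.

Lemma term_par C' P Q : ter P -> ter Q -> ter (ppar C' P Q).
Proof. by move=> *; apply: ws_rule (sos_par_term E C' P Q) _ => k [] ->. Qed.

Lemma term_parP C' P Q : ter (ppar C' P Q) -> ter P /\ ter Q.
Proof. by move=> w; invert w; split; apply: hK; [left|right]. Qed.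

(** * Divergence preservation as well-foundedness *)

(** The conclusion of the divergence condition, at a single state [s] of the path. *)
Definition answered R t s := exists2 t', tau_plus t t' & R s t'.

(* A tau-step from [s] to [s'], oriented for [Acc]. *)
Definition unanswered_step R t s' s := tau_step E s s' /\ ~ answered R t s.

Definition divergence_wf R := forall s t, R s t -> Acc (unanswered_step R t) s.

Definition dp_bisimulation R := branching_bisimulation E R /\ divergence_wf R.

Lemma Acc_answered R t s : answered R t s -> Acc (unanswered_step R t) s.
Proof. by move=> ans; constructor=> s' [_ /(_ ans)]. Qed.

Lemma tau_star_opt t t'' t' : tau_star t t'' -> opt_trans E t'' tau t' ->
  t = t' \/ tau_plus t t'.
Proof.
move=> tt'' [t''t'|[_ <-]]; last exact: clos_rt_eq_or_t.
by right; apply: clos_rt_t tt'' _; constructor.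
Qed.

(** To match a tau-step, [t] either stays put or follows a proper tau-path, and the latter is an
    answer. *)
Lemma tau_step_answered R s t s' : branching_bisimulation E R ->
  R s t -> tau_step E s s' -> R s' t \/ answered R t s'.
Proof.
move=> [_ simR _] st /(simR _ _ _ _ st)[t'' [t' [tt'' t''t' _ s't']]].
by have [->|tt'] := tau_star_opt tt'' t''t'; [left|right; exists t'].
Qed.

Lemma divergence_wf_preserving R : divergence_wf R -> divergence_preserving E R.
Proof.
move=> wfR s t f st f0 fstep _; apply: contrapT => nans.
apply: (Acc_no_path (wfR _ _ st) f0) => i; split; first exact: fstep.
by move=> [t' tt' fit']; apply: nans; exists t', i.
Qed.

Lemma divergence_preserving_wf R : branching_bisimulation E R ->
  divergence_preserving E R -> divergence_wf R.
Proof.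
move=> bR dR s t st; apply: contrapT => nacc.
have [f f0 fstep] := not_Acc_path nacc.
(* Each [f i.+1] is itself the source of an unanswered step, so the path can never leave the states
   related to [t]. *)
have fR i : R (f i) t.
  elim: i => [|i IH]; first by rewrite f0.
  by have [//|/(fstep i.+1).2] := tau_step_answered bR IH (fstep i).1.
have [t' [i [tt' fit']]] := dR s t f st f0 (fun i => (fstep i).1) fR.
by apply: (fstep i).2; exists t'.
Qed.

Lemma answered_sub R R' t s : inclusion _ R R' ->
  answered R t s -> answered R' t s.
Proof. by move=> sub [t' tt' st']; exists t' => //; apply: sub. Qed.

(** Enlarging the relation answers more states and so removes unanswered steps. *)
Lemma Acc_unanswered_sub R R' t s : inclusion _ R R' ->
  Acc (unanswered_step R t) s -> Acc (unanswered_step R' t) s.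
Proof.
move=> sub; apply: Acc_incl => y x [xy nans]; split=> // ans.
exact: nans (answered_sub sub ans).
Qed.

Lemma dp_bisimulation_union R1 R2 : dp_bisimulation R1 -> dp_bisimulation R2 ->
  dp_bisimulation (union _ R1 R2).
Proof.
move=> [[sy1 sim1 tm1] wf1] [[sy2 sim2 tm2] wf2]; split; first split.
- by move=> s t [/sy1|/sy2]; [left|right].
- move=> s t a s' [st|st].
  + by move=> /(sim1 _ _ _ _ st)[t'' [t' [? ? ? ?]]]; exists t'', t'; split=> //; left.
  + by move=> /(sim2 _ _ _ _ st)[t'' [t' [? ? ? ?]]]; exists t'', t'; split=> //; right.
- move=> s t [st|st].
  + by move=> /(tm1 _ _ st)[t' [? ? ?]]; exists t'; split=> //; left.
  + by move=> /(tm2 _ _ st)[t' [? ? ?]]; exists t'; split=> //; right.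
- move=> s t [st|st].
  + by apply: Acc_unanswered_sub (wf1 _ _ st) => x y; left.
  + by apply: Acc_unanswered_sub (wf2 _ _ st) => x y; right.
Qed.

(** Reduces each congruence to root conditions towards a known bisimulation: adding all pairs rooted
    in both directions keeps it one, since after one matched step they land in [R]. *)
Lemma rooted_pair_bisimilar R s t : dp_bisimulation R ->
  root_condition E R s t -> root_condition E R t s ->
  rooted_dp_branching_bisimilar E s t.
Proof.
move=> [[sy sim tm] wf] rst rts.
pose R' : relation process := fun x y =>
  R x y \/ [/\ root_condition E R x y & root_condition E R y x].
have sub : inclusion _ R R' by move=> x y; left.
have bR' : branching_bisimulation E R'.
  split.
  - by move=> x y [/sy|[]]; [left|right].
  - move=> x y a x' [xy|[rxy ryx]].
      by move=> /(sim _ _ _ _ xy)[y'' [y' [? ? ? ?]]]; exists y'', y'; split=> //; left.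
    move=> /rxy.1[y' [yy' x'y']]; exists y, y'.
    by split; [apply: rt_refl|left|right|left].
  - move=> x y [xy|[rxy ryx]].
      by move=> /(tm _ _ xy)[y' [? ? ?]]; exists y'; split=> //; left.
    by move=> /rxy.2 ty; exists y; split; [apply: rt_refl| |right].
exists R'; split=> //; last first.
- split; last exact: rts.2.
  by move=> a t' /rts.1[s' [? ?]]; exists s'; split=> //; left.
- split; last exact: rst.2.
  by move=> a s' /rst.1[t' [? ?]]; exists t'; split=> //; left.
- by right.
apply: divergence_wf_preserving => x y [/wf|[rxy _]].
  exact: Acc_unanswered_sub.
constructor=> x' [/rxy.1[y' [yy' x'y']] _].
by apply: Acc_answered; exists y'; [constructor|left].
Qed.

Lemma rooted_dp_bisimulation P Q : rooted_dp_branching_bisimilar E P Q ->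
  exists2 R, dp_bisimulation R &
    [/\ R P Q, root_condition E R P Q & root_condition E R Q P].
Proof.
move=> [R [bR dR PQ rPQ rQP]]; exists R; last by split.
by split; [exact: bR|exact: divergence_preserving_wf].
Qed.

Lemma root_condition_sub R R' s t : inclusion _ R R' ->
  root_condition E R s t -> root_condition E R' s t.
Proof.
move=> sub [rt rterm]; split=> // a s' /rt[t' [tt' s't']].
by exists t'; split=> //; apply: sub.
Qed.

(** * Congruence for each operator *)

Lemma rooted_prefix a P Q : rooted_dp_branching_bisimilar E P Q ->
  rooted_dp_branching_bisimilar E (pprefix a P) (pprefix a Q).
Proof.
move=> /rooted_dp_bisimulation[R dpR [PQ _ _]].
have QP : R Q P by case: dpR => -[sy _ _] _; apply: sy.
by apply: (rooted_pair_bisimilar dpR); split=> [b X /trans_prefixP[<- <-]|/term_prefix//];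
  eexists; split; (exact: trans_prefix || by []).
Qed.

Lemma root_plus R P1 P2 Q1 Q2 :
  root_condition E R P1 Q1 -> root_condition E R P2 Q2 ->
  root_condition E R (pplus P1 P2) (pplus Q1 Q2).
Proof.
move=> [r1 t1] [r2 t2]; split=> [a X /trans_plusP[/r1|/r2] [Y [? ?]]|].
- by exists Y; split=> //; apply: trans_plusl.
- by exists Y; split=> //; apply: trans_plusr.
- by move=> /term_plusP[/t1|/t2]; [apply: term_plusl|apply: term_plusr].
Qed.

(** The summands come with different bisimulations; after the first step only one summand survives,
    so their union serves both. *)
Lemma rooted_plus P1 P2 Q1 Q2 :
  rooted_dp_branching_bisimilar E P1 Q1 ->
  rooted_dp_branching_bisimilar E P2 Q2 ->
  rooted_dp_branching_bisimilar E (pplus P1 P2) (pplus Q1 Q2).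
Proof.
move=> /rooted_dp_bisimulation[R1 dp1 [_ r1 r1']].
move=> /rooted_dp_bisimulation[R2 dp2 [_ r2 r2']].
have subl : inclusion _ R1 (union _ R1 R2) by move=> x y; left.
have subr : inclusion _ R2 (union _ R1 R2) by move=> x y; right.
by apply: (rooted_pair_bisimilar (dp_bisimulation_union dp1 dp2));
  apply: root_plus; do [exact: root_condition_sub subl _|exact: root_condition_sub subr _].
Qed.

(** * Deadlocked processes and sequential composition *)

Lemma deadlocked_tau_plus s t : deadlocked s -> ~ tau_plus s t.
Proof. by move=> ds st; elim: st ds => [x y xy ds|x y z _ IH _ _ /IH]; first exact: ds xy. Qed.

Lemma deadlocked_tau_star s t : deadlocked s -> tau_star s t -> s = t.
Proof. by move=> ds st; have [//|/(deadlocked_tau_plus ds)] := clos_rt_eq_or_t st. Qed.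

Lemma deadlocked_match R X Y : dp_bisimulation R -> R X Y ->
  ter X -> deadlocked X ->
  exists Y', [/\ tau_star Y Y', ter Y', deadlocked Y' & R X Y'].
Proof.
move=> [[sy sim tm] wf] XY tX dX.
(* A deadlocked [X] has no proper tau-descendant and answers nothing, so this accessibility says
   that [Y] does not diverge. *)
have accY := wf _ _ (sy _ _ XY).
elim: accY XY => {}Y _ IH XY.
have [dY|ndY] := pselect (deadlocked Y).
  have [Y' [YY' tY' XY']] := tm _ _ XY tX.
  by exists Y'; split=> //; rewrite -(deadlocked_tau_star dY YY').
have [a [Y1 YY1]] : exists a Y1, tr Y a Y1.
  apply: contrapT => nex; apply: ndY => a Y1 YY1; apply: nex; by exists a, Y1.
have [X'' [X' [XX'' XX' _ Y1X']]] := sim _ _ _ _ (sy _ _ XY) YY1.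
(* [X] can only match by staying put, which forces the action to be [tau] and keeps [X] related to
   [Y1]. *)
move: XX' Y1X'; rewrite -(deadlocked_tau_star dX XX'') => -[/dX//|[ea <-]].
move=> /sy XY1; rewrite {}ea in YY1.
have [] // := IH Y1.
  by split=> // -[X1 /(deadlocked_tau_plus dX)].
move=> Y' [Y1Y' tY' dY' XY']; exists Y'; split=> //.
by apply: rt_trans Y1Y'; constructor.
Qed.

Lemma tau_star_seql X X' A : tau_star X X' -> tau_star (pseq X A) (pseq X' A).
Proof.
apply: (@clos_rt_map _ _ _ _ (fun X => pseq X A)) => x y; exact: trans_seql.
Qed.

Lemma tau_plus_seql X X' A : tau_plus X X' -> tau_plus (pseq X A) (pseq X' A).
Proof.
apply: (@clos_t_map _ _ _ _ (fun X => pseq X A)) => x y; exact: trans_seql.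
Qed.

Section Sequential.
Variables R1 R2 : relation process.
Hypotheses (cE : complete E).
Hypotheses (dp1 : dp_bisimulation R1) (dp2 : dp_bisimulation R2).

(** The second components are rooted because, at the handover, the first step of [P] needs a real
    step of [Q]. Afterwards the first component is gone and [R2] alone remains. *)
Inductive seq_rel : relation process :=
| seq_rel_pair X Y P Q of R1 X Y & R2 P Q & root_condition E R2 P Q
    & root_condition E R2 Q P : seq_rel (pseq X P) (pseq Y Q)
| seq_rel_tail P Q of R2 P Q : seq_rel P Q.

Lemma seq_rel_right X Y P Q a P' : R1 X Y -> root_condition E R2 P Q ->
  ter X -> deadlocked X -> tr P a P' ->
  exists Y' Q', [/\ tau_star Y Y', R1 X Y', tr (pseq Y' Q) a Q' & R2 P' Q'].
Proof.
move=> XY rPQ tX dX /rPQ.1[Q' [QQ' P'Q']].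
have [Y' [YY' tY' dY' XY']] := deadlocked_match dp1 XY tX dX.
by exists Y', Q'; split=> //; apply: trans_seqr.
Qed.

Lemma dp_bisimulation_seq_rel : dp_bisimulation seq_rel.
Proof.
have [b1 wf1] := dp1; have [b2 wf2] := dp2.
have [sy1 sim1 tm1] := b1; have [sy2 sim2 tm2] := b2.
have sub : inclusion _ R2 seq_rel by move=> x y; right.
split; first split.
- by move=> _ _ [X Y P Q /sy1 ? /sy2 ? ? ?|P Q /sy2 ?]; [left|right].
- move=> s t a s' []; last first.
    move=> P Q PQ /(sim2 _ _ _ _ PQ)[Q'' [Q' [? ? ? ?]]].
    by exists Q'', Q'; split=> //; right.
  move=> X Y P Q XY PQ rPQ rQP /trans_seqP[[X' -> XX']|[tX dX PP']].
    have [Y'' [Y' [YY'' Y''Y' XY'' X'Y']]] := sim1 _ _ _ _ XY XX'.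
    exists (pseq Y'' Q), (pseq Y' Q); split; [exact: tau_star_seql| |by left|by left].
    case: Y''Y' => [Y''Y'|[-> ->]]; [by left; apply: trans_seql|by right].
  have [Y' [Q' [YY' XY' Y'QQ' P'Q']]] := seq_rel_right XY rPQ tX dX PP'.
  exists (pseq Y' Q), Q'.
  by split; [exact: tau_star_seql|left|left|right].
- move=> s t []; last first.
    by move=> P Q PQ /(tm2 _ _ PQ)[Q' [? ? ?]]; exists Q'; split=> //; right.
  move=> X Y P Q XY PQ rPQ rQP /term_seqP[/(tm1 _ _ XY)[Y' [YY' tY' XY']] /rPQ.2 tQ].
  by exists (pseq Y' Q); split; [exact: tau_star_seql|exact: term_seq|left].
move=> s t [] {s t}; last by move=> P Q /wf2; apply: Acc_unanswered_sub.
move=> X Y P Q XY PQ rPQ rQP.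
have accX := wf1 _ _ XY.
elim: accX XY => {}X _ IH XY.
constructor=> Z [/trans_seqP[[X' -> XX']|[tX dX PP']] nans].
  have [X'Y|[Y' YY' X'Y']] := tau_step_answered b1 XY XX'.
    (* An answer to [X] by a descendant of [Y] would lift to the compound processes, against
       [nans]. *)
    apply: IH => //; split=> // -[Y' YY' XY']; apply: nans.
    by exists (pseq Y' Q); [apply: tau_plus_seql|left].
  apply: Acc_answered; exists (pseq Y' Q); [exact: tau_plus_seql|by left].
have [Y' [Q' [YY' XY' Y'QQ' P'Q']]] := seq_rel_right XY rPQ tX dX PP'.
(* The root condition makes the handover a real tau-step, so the path to [Q'] is proper. *)
apply: Acc_answered; exists Q'; last by right.
by apply: clos_rt_t (tau_star_seql _ YY') _; constructor.
Qed.

(** The root condition from [Q1] back to [P1] makes [Q1] deadlocked as soon as [P1] is, so [Q2] can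
    start at once. *)
Lemma root_seq P1 P2 Q1 Q2 : R2 P2 Q2 ->
  root_condition E R1 P1 Q1 -> root_condition E R1 Q1 P1 ->
  root_condition E R2 P2 Q2 -> root_condition E R2 Q2 P2 ->
  root_condition E seq_rel (pseq P1 P2) (pseq Q1 Q2).
Proof.
move=> PQ2 r1 r1' r2 r2'; split; last first.
  by move=> /term_seqP[/r1.2 ? /r2.2 ?]; apply: term_seq.
move=> a X /trans_seqP[[P1' -> /r1.1[Q1' [? ?]]]|[tP1 dP1 /r2.1[Q2' [? ?]]]].
  by exists (pseq Q1' Q2); split; [exact: trans_seql|left].
exists Q2'; split; last by right.
apply: trans_seqr => //; first exact: r1.2.
by move=> b Q1' /r1'.1[P1' [/dP1]].
Qed.

End Sequential.

Lemma rooted_seq P1 P2 Q1 Q2 : complete E ->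
  rooted_dp_branching_bisimilar E P1 Q1 ->
  rooted_dp_branching_bisimilar E P2 Q2 ->
  rooted_dp_branching_bisimilar E (pseq P1 P2) (pseq Q1 Q2).
Proof.
move=> cE /rooted_dp_bisimulation[R1 dp1 [_ r1 r1']].
move=> /rooted_dp_bisimulation[R2 dp2 [PQ2 r2 r2']].
have QP2 : R2 Q2 P2 by case: dp2 => -[sy _ _] _; apply: sy.
by apply: (rooted_pair_bisimilar (dp_bisimulation_seq_rel cE dp1 dp2));
  apply: root_seq.
Qed.

(** * Parallel composition *)

Section Parallel.
Variables (C' : set C) (R1 R2 : relation process).
Hypotheses (dp1 : dp_bisimulation R1) (dp2 : dp_bisimulation R2).

Inductive par_rel : relation process :=
| par_rel_pair X Y P Q of R1 X Y & R2 P Q : par_rel (ppar C' X P) (ppar C' Y Q).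

Lemma tau_step_parl X X' A : tau_step E X X' ->
  tau_step E (ppar C' X A) (ppar C' X' A).
Proof. exact/trans_parl/tau_not_comm. Qed.

Lemma tau_step_parr X A A' : tau_step E A A' ->
  tau_step E (ppar C' X A) (ppar C' X A').
Proof. exact/trans_parr/tau_not_comm. Qed.

Lemma tau_star_par X X' A A' : tau_star X X' -> tau_star A A' ->
  tau_star (ppar C' X A) (ppar C' X' A').
Proof.
move=> XX' AA'; apply: rt_trans.
- by apply: (@clos_rt_map _ _ _ _ (fun X => ppar C' X A)) XX' => ? ?; exact: tau_step_parl.
- by apply: (@clos_rt_map _ _ _ _ (ppar C' X')) AA' => ? ?; exact: tau_step_parr.
Qed.

Lemma tau_plus_parl X X' A : tau_plus X X' ->
  tau_plus (ppar C' X A) (ppar C' X' A).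
Proof.
by apply: (@clos_t_map _ _ _ _ (fun X => ppar C' X A)) => ? ?; exact: tau_step_parl.
Qed.

Lemma tau_plus_parr X A A' : tau_plus A A' ->
  tau_plus (ppar C' X A) (ppar C' X A').
Proof.
by apply: (@clos_t_map _ _ _ _ (ppar C' X)) => ? ?; exact: tau_step_parr.
Qed.

Lemma answered_parl X Y P Q : R2 P Q ->
  answered R1 Y X -> answered par_rel (ppar C' Y Q) (ppar C' X P).
Proof.
by move=> PQ [Y' YY' XY']; exists (ppar C' Y' Q); [exact: tau_plus_parl|].
Qed.

Lemma answered_parr X Y P Q : R1 X Y ->
  answered R2 Q P -> answered par_rel (ppar C' Y Q) (ppar C' X P).
Proof.
by move=> XY [Q' QQ' PQ']; exists (ppar C' Y Q'); [exact: tau_plus_parr|].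
Qed.

(** Visible actions cannot be matched by stuttering, so both matches contain a real step and these
    synchronise after the silent prefixes. *)
Lemma par_rel_handshake X Y P Q a b X' P' : R1 X Y -> R2 P Q ->
  handshake C' a b -> tr X a X' -> tr P b P' ->
  exists Y'' Q'' Y' Q',
    [/\ tau_star Y Y'' /\ tau_star Q Q'', R1 X Y'' /\ R2 P Q'',
        R1 X' Y' /\ R2 P' Q' & tau_step E (ppar C' Y'' Q'') (ppar C' Y' Q')].
Proof.
have [[_ sim1 _] _] := dp1; have [[_ sim2 _] _] := dp2.
move=> XY PQ hab /(sim1 _ _ _ _ XY)[Y'' [Y' [? oY ? ?]]].
move=> /(sim2 _ _ _ _ PQ)[Q'' [Q' [? oQ ? ?]]].
exists Y'', Q'', Y', Q'; split=> //.
have [na nb] := handshake_visible hab.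
by case: oY => [?|[/na]] //; case: oQ => [?|[/nb]] //; apply: trans_comm hab _ _.
Qed.

Lemma dp_bisimulation_par_rel : dp_bisimulation par_rel.
Proof.
have [b1 wf1] := dp1; have [b2 wf2] := dp2.
have [sy1 sim1 tm1] := b1; have [sy2 sim2 tm2] := b2.
split; first split.
- by move=> _ _ [X Y P Q /sy1 ? /sy2 ?].
- move=> s t a s' [] {s t} X Y P Q XY PQ /trans_parP[].
  + move=> [na [X' -> /(sim1 _ _ _ _ XY)[Y'' [Y' [? oY ? ?]]]]].
    exists (ppar C' Y'' Q), (ppar C' Y' Q).
    split=> //; first by apply: tau_star_par => //; apply: rt_refl.
    by case: oY => [?|[-> ->]]; [left; apply: trans_parl|right].
  + move=> [na [P' -> /(sim2 _ _ _ _ PQ)[Q'' [Q' [? oQ ? ?]]]]].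
    exists (ppar C' Y Q''), (ppar C' Y Q').
    split=> //; first by apply: tau_star_par => //; apply: rt_refl.
    by case: oQ => [?|[-> ->]]; [left; apply: trans_parr|right].
  + move=> [-> [b [b' [X' [P' [-> hab XX' PP']]]]]].
    have [Y'' [Q'' [Y' [Q' [[? ?] [? ?] [? ?] ?]]]]] :=
      par_rel_handshake XY PQ hab XX' PP'.
    exists (ppar C' Y'' Q''), (ppar C' Y' Q').
    by split=> //; [exact: tau_star_par|left].
- move=> s t [] {s t} X Y P Q XY PQ /term_parP[].
  move=> /(tm1 _ _ XY)[Y' [? ? ?]] /(tm2 _ _ PQ)[Q' [? ? ?]].
  by exists (ppar C' Y' Q'); split=> //; [exact: tau_star_par|exact: term_par].
move=> s t [] {s t} X Y P Q XY PQ.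
have [accX accP] := (wf1 _ _ XY, wf2 _ _ PQ).
elim: accX P accP XY PQ => {}X _ IH1 P accP.
(* Nested induction: left steps use the outer hypothesis, right steps the inner one. A copy of
   [accP] is kept for the outer hypothesis, which applies to the same [P]. *)
elim: accP (accP) => {}P _ IH2 accP XY PQ.
constructor=> Z [/trans_parP[] [_]] => [[X' -> XX']|[P' -> PP']|step] nans.
- have [X'Y|ans] := tau_step_answered b1 XY XX'; last first.
    exact/Acc_answered/answered_parl.
  by apply: IH1; [split=> // /(answered_parl PQ)|exact: accP|exact: X'Y|exact: PQ].
- have [P'Q|ans] := tau_step_answered b2 PQ PP'; last first.
    exact/Acc_answered/answered_parr.
  by apply: IH2; [split=> // /(answered_parr XY)|exact: wf2|exact: XY|exact: P'Q].
case: step => b [b' [X' [P' [-> hab XX' PP']]]].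
have [Y'' [Q'' [Y' [Q' [[? ?] [? ?] [? ?] ?]]]]] :=
  par_rel_handshake XY PQ hab XX' PP'.
(* A communication is itself a tau-step, so its match is a proper tau-path and no induction is
   involved. *)
apply: Acc_answered; exists (ppar C' Y' Q') => //.
by apply: clos_rt_t (tau_star_par _ _) _; last by constructor; eassumption.
Qed.

(** When only one component moves, the other stays paired by [PQ1] or [PQ2]. *)
Lemma root_par P1 P2 Q1 Q2 : R1 P1 Q1 -> R2 P2 Q2 ->
  root_condition E R1 P1 Q1 -> root_condition E R2 P2 Q2 ->
  root_condition E par_rel (ppar C' P1 P2) (ppar C' Q1 Q2).
Proof.
move=> PQ1 PQ2 r1 r2; split; last first.
  by move=> /term_parP[/r1.2 ? /r2.2 ?]; apply: term_par.
move=> a X /trans_parP[].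
- move=> [na [P1' -> /r1.1[Q1' [? ?]]]].
  by exists (ppar C' Q1' Q2); split=> //; apply: trans_parl.
- move=> [na [P2' -> /r2.1[Q2' [? ?]]]].
  by exists (ppar C' Q1 Q2'); split=> //; apply: trans_parr.
- move=> [-> [b [b' [P1' [P2' [-> hab /r1.1[Q1' [? ?]] /r2.1[Q2' [? ?]]]]]]]].
  by exists (ppar C' Q1' Q2'); split=> //; apply: trans_comm hab _ _.
Qed.

End Parallel.

Lemma rooted_par C' P1 P2 Q1 Q2 :
  rooted_dp_branching_bisimilar E P1 Q1 ->
  rooted_dp_branching_bisimilar E P2 Q2 ->
  rooted_dp_branching_bisimilar E (ppar C' P1 P2) (ppar C' Q1 Q2).
Proof.
move=> /rooted_dp_bisimulation[R1 dp1 [PQ1 r1 r1']].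
move=> /rooted_dp_bisimulation[R2 dp2 [PQ2 r2 r2']].
have QP1 : R1 Q1 P1 by case: dp1 => -[sy _ _] _; apply: sy.
have QP2 : R2 Q2 P2 by case: dp2 => -[sy _ _] _; apply: sy.
by apply: (rooted_pair_bisimilar (dp_bisimulation_par_rel C' dp1 dp2));
  apply: root_par.
Qed.

End Congruence.

Theorem theorem1 (B C D : Type) (Name : countType) (E : rec_spec B C D Name) :
  (forall (a : action_tau B C D) (P Q : proc B C D Name),
      rooted_dp_branching_bisimilar E P Q ->
      rooted_dp_branching_bisimilar E (pprefix a P) (pprefix a Q)) /\
  (forall P1 P2 Q1 Q2 : proc B C D Name,
      rooted_dp_branching_bisimilar E P1 Q1 ->
      rooted_dp_branching_bisimilar E P2 Q2 ->
      [/\ rooted_dp_branching_bisimilar E (pplus P1 P2) (pplus Q1 Q2),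
          complete E ->
            rooted_dp_branching_bisimilar E (pseq P1 P2) (pseq Q1 Q2)
        & forall C' : set C,
            rooted_dp_branching_bisimilar E (ppar C' P1 P2) (ppar C' Q1 Q2)]).
Proof.
split=> [a P Q|P1 P2 Q1 Q2 PQ1 PQ2]; first exact: rooted_prefix.
split=> [|cE|C'].
- exact: rooted_plus.
- exact: rooted_seq.
- exact: rooted_par.
Qed.
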